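(* Let $\mathfrak{P}_2$ be the set of all $2$-variate probability distributions $\bar p=\{p_{i_1i_2}\}_{(i_1,i_2)\in\mathbb{N}_0^2}$ and put $$L_{I(X_1:X_2)}(\bar p|\varepsilon)=\inf\left\{I(X_1\!:\!X_2)_{\bar q}\,:\,\bar q\in\mathfrak{P}_2,\ \mathrm{TV}(\bar p,\bar q)\le\varepsilon\right\}.$$ Let $\widetilde I(X_1\!:\!X_2)$ be the homogeneous extension of the mutual information $I(X_1\!:\!X_2)$ to the cone of (summable) $2$-variate arrays of nonnegative numbers. A) If $\bar p$ is an arbitrary probability distribution in $\mathfrak{P}_2$ then $$L_{I(X_1:X_2)}(\bar p|\varepsilon)\ge\widetilde I(X_1\!:\!X_2)_{[\bar p-\varepsilon]_+}-2g(\varepsilon)-\tilde h_2(\varepsilon)-h_2(1-r_\varepsilon)\qquad\forall\varepsilon\in(0,1],\qquad\text{(i)}$$ where $r_\varepsilon=\sum_{i_1,i_2}[p_{i_1i_2}-\varepsilon]_+$. B) If $\bar p\in\mathfrak{P}_2$ is such that $I(X_1\!:\!X_2)_{\bar p}<+\infty$ then $$L_{I(X_1:X_2)}(\bar p|\varepsilon)\ge I(X_1\!:\!X_2)_{\bar p}-\widetilde I(X_1\!:\!X_2)_{\bar p\wedge\varepsilon}-2g(\varepsilon)-\tilde h_2(\varepsilon)\qquad\forall\varepsilon\in(0,1].\qquad\text{(ii)}$$ The lower bounds (i) and (ii) are faithful: their right hand sides tend to $I(X_1\!:\!X_2)_{\bar p}\le+\infty$ as $\varepsilon\to0$.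
   Context: $\mathbb{N}_0$ is the set of nonnegative integers. $\mathrm{TV}(\bar p,\bar q)=\frac12\sum_{i_1,i_2}|p_{i_1i_2}-q_{i_1i_2}|$; $[x]_+=\max\{x,0\}$. The mutual information of random variables $X_1,X_2$ with joint distribution $\bar p$ is $I(X_1\!:\!X_2)_{\bar p}=D_{KL}(\bar p\|\bar p_1\times\bar p_2)\in[0,+\infty]$, where $\bar p_1,\bar p_2$ are the marginal distributions of $\bar p$, $\bar p_1\times\bar p_2$ is their product, and $D_{KL}(\bar x\|\bar y)=\sum_jx_j\ln(x_j/y_j)$ (with $0\ln0=0$) is the Kullback–Leibler divergence. Its homogeneous extension is $\widetilde I(X_1\!:\!X_2)_{\bar p}=\|\bar p\|_1I(X_1\!:\!X_2)_{\bar p/\|\bar p\|_1}$, $\|\bar p\|_1=\sum_{i_1,i_2}p_{i_1i_2}$, for nonzero arrays, and $0$ at the zero array. $\bar p\wedge\varepsilon=\{\min\{p_{i_1i_2},\varepsilon\}\}$, $[\bar p-\varepsilon]_+=\{\max\{p_{i_1i_2}-\varepsilon,0\}\}$. $\eta(x)=-x\ln x$ for $x>0$, $\eta(0)=0$; $h_2(p)=\eta(p)+\eta(1-p)$; $\tilde h_2(p)=h_2(p)$ for $p\in[0,\frac12]$ and $\tilde h_2(p)=\ln2$ for $p\in(\frac12,1]$; $g(x)=(x+1)\ln(x+1)-x\ln x$ for $x>0$, $g(0)=0$. *)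

(* Defs.v *)
From mathcomp Require Import all_boot all_order all_algebra.
From mathcomp Require Import all_classical all_reals all_analysis.

Set Implicit Arguments.
Unset Strict Implicit.
Unset Printing Implicit Defensive.

Import Order.TTheory GRing.Theory Num.Theory.
Import numFieldNormedType.Exports.

Local Open Scope classical_set_scope.
Local Open Scope ring_scope.

(* A 2-variate array {p_ij} is a function p : nat * nat -> R. *)

Section Arrays.
Context {R : realType}.
Implicit Types p q : nat * nat -> R.

Definition is_distr p : Prop :=
  (forall ij, 0 <= p ij) /\ (\esum_(ij in setT) (p ij)%:E = 1)%E.

(* Real-valued, hence the intended sum only for summable nonnegative arrays
   (the value is 0 when the sum is infinite). *)
Definition arr_mass p : R := fine (\esum_(ij in setT) (p ij)%:E).

Definition TVdist p q : \bar R :=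
  ((2^-1)%:E * \esum_(ij in setT) `|p ij - q ij|%:E)%E.

Definition marg1 p (i : nat) : R := fine (\esum_(j in setT) (p (i, j))%:E).
Definition marg2 p (j : nat) : R := fine (\esum_(i in setT) (p (i, j))%:E).

Definition prod_marg p (ij : nat * nat) : R := marg1 p ij.1 * marg2 p ij.2.

(* x ln(x/y) with 0 ln(0/y) = 0 and x ln(x/0) = +oo for x > 0. *)
Definition kl_term (x y : R) : \bar R :=
  if x == 0 then 0%E else if y == 0 then +oo%E else (x * ln (x / y))%:E.

(* The terms have both signs: the sum is that of the positive parts minus that
   of the negative parts. Since x ln(x/y) >= x - y, the latter is finite for
   summable nonnegative x and y, so +oo - +oo does not occur. *)
Definition DKL (I : choiceType) (x y : I -> R) : \bar R :=
  let t := fun j => kl_term (x j) (y j) in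
  (\esum_(j in setT) t^\+ j - \esum_(j in setT) t^\- j)%E.

Definition mutual_info p : \bar R := DKL p (prod_marg p).

Definition hext (F : (nat * nat -> R) -> \bar R) p : \bar R :=
  if arr_mass p == 0 then 0%E
  else ((arr_mass p)%:E * F (fun ij => (p ij / arr_mass p)%R))%E.

Definition trunc_arr p (eps : R) : nat * nat -> R := fun ij => Num.min (p ij) eps.

Definition excess_arr p (eps : R) : nat * nat -> R :=
  fun ij => Num.max (p ij - eps) 0.

Definition lower_env (F : (nat * nat -> R) -> \bar R) p (eps : R) : \bar R :=
  ereal_inf [set F q | q in [set q | is_distr q /\ (TVdist p q <= eps%:E)%E]].

Definition eta (x : R) : R := if 0 < x then - (x * ln x) else 0.

Definition h2 (x : R) : R := eta x + eta (1 - x).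

Definition h2t (x : R) : R := if x <= 2^-1 then h2 x else ln 2.

Definition g_fun (x : R) : R :=
  if 0 < x then (x + 1) * ln (x + 1) - x * ln x else 0.

End Arrays.

(* Main.v *)
(* The mutual information of an array a with mass A and marginals a_i, a_j is
   the sum of the terms a ln(a A / (a_i a_j)) - a + a_i a_j / A, which are all
   nonnegative and total to the homogeneous extension; call it info a.
   Comparing terms by means of ln x <= x - 1 gives, for arrays of masses A and B,
     |info (a + b) - info a - info b| <= F(A, B),
     F(A, B) = A ln((A+B)/A) + B ln((A+B)/B),
   even when marginal entropies are infinite.
   Let TV(p, q) <= eps. Then [p - eps]_+ <= q, which gives (i) at once. For (ii)
   put u = [p - q]_+ and v = [q - p]_+, of common mass m <= eps; evaluating
   info (p + v) = info (q + u) in two ways yields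
   info p <= info q + info u + 2 F(m, 1) with F(m, 1) <= g(eps), and info u is
   compared with info (p /\ eps), as u <= p /\ eps.
   The bounds are at most info p since q = p is admissible. The liminf of (i)
   is at least info p by lower semicontinuity (finite subsums converge), and
   (ii) dominates (i) when info p is finite, by superadditivity applied to
   p = [p - eps]_+ + p /\ eps. *)

Require Import Defs.
From mathcomp Require Import all_boot all_order all_algebra.
From mathcomp Require Import all_classical all_reals all_analysis.
From mathcomp Require Import ring lra.
Import Order.TTheory GRing.Theory Num.Theory.
Import numFieldNormedType.Exports.
Local Open Scope classical_set_scope.
Local Open Scope ring_scope.

Set Implicit Arguments.
Unset Strict Implicit.
Unset Printing Implicit Defensive.

(** * Sums of real-valued families and marginals *)

Section RealSums.
Context {R : realType}.

(** Real terms with an extended sum: termwise estimates stay in [R], within reach of [lra], while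
    infinite totals remain meaningful. *)
Definition rsum {T : choiceType} (f : T -> R) : \bar R :=
  \esum_(t in setT) (f t)%:E.

Lemma rsum_ge0 (T : choiceType) (f : T -> R) :
  (forall t, 0 <= f t) -> (0 <= rsum f)%E.
Proof. by move=> f0; apply: esum_ge0 => t _; rewrite lee_fin. Qed.

Lemma le_rsum (T : choiceType) (f g : T -> R) :
  (forall t, f t <= g t) -> (rsum f <= rsum g)%E.
Proof. by move=> fg; apply: le_esum => t _; rewrite lee_fin. Qed.

Lemma eq_rsum (T : choiceType) (f g : T -> R) :
  f =1 g -> rsum f = rsum g.
Proof. by move=> fg; apply: eq_esum => t _; rewrite fg. Qed.

Lemma rsum0 (T : choiceType) : rsum (fun _ : T => 0) = 0%E.
Proof. exact: esum1. Qed.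

Lemma rsumD (T : choiceType) (f g : T -> R) :
  (forall t, 0 <= f t) -> (forall t, 0 <= g t) ->
  rsum (fun t => f t + g t) = (rsum f + rsum g)%E.
Proof.
move=> f0 g0; rewrite /rsum -esumD; first by apply: eq_esum => t _; rewrite EFinD.
  by move=> t _; rewrite lee_fin.
by move=> t _; rewrite lee_fin.
Qed.

Lemma rsum_ge1 (T : choiceType) (f : T -> R) (t : T) :
  (forall t, 0 <= f t) -> ((f t)%:E <= rsum f)%E.
Proof.
move=> f0; apply: esum_ge; exists [set t]; first by split.
by rewrite fsbig_set1.
Qed.

(** The sum is a supremum over finite subsets, and a nonnegative factor passes through finite sums
    and suprema alike, even if the total is infinite. *)
Lemma rsumZ (T : choiceType) (c : R) (f : T -> R) : 0 <= c ->
  rsum (fun t => c * f t) = (c%:E * rsum f)%E.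
Proof.
move=> c0; rewrite /rsum /esum -ereal_supZl//; last first.
  by apply/set0P; exists 0%E, set0; [exact: fsets_set0|rewrite fsbig_set0].
rewrite image_comp; congr ereal_sup; apply: eq_imagel => X [finX _] /=.
by rewrite !fsbig_finite// !sumEFin -EFinM mulr_sumr.
Qed.

Lemma rsum_pair (f : nat * nat -> R) : (forall ij, 0 <= f ij) ->
  rsum f = \esum_(i in setT) rsum (fun j => f (i, j)).
Proof.
move=> f0; rewrite /rsum esum_esum; last by move=> *; rewrite lee_fin.
rewrite [in RHS](_ : setT `*`` _ = setT); last by apply/seteqP; split.
by apply: eq_esum => -[i j].
Qed.

(** Transposition, by which facts about columns are deduced from those about rows. *)
Definition swap_arr (f : nat * nat -> R) : nat * nat -> R := fun ij => f (ij.2, ij.1).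

Lemma rsum_swap (f : nat * nat -> R) : rsum (swap_arr f) = rsum f.
Proof.
symmetry; apply: (@reindex_esum R _ _ setT setT (fun ij => (ij.2, ij.1))).
split => //=; first by move=> [i j] [k l] _ _ [-> ->].
by move=> [i j] _; exists (j, i).
Qed.

Lemma rsum_prod (u v : nat -> R) (U V : R) :
  (forall i, 0 <= u i) -> (forall j, 0 <= v j) ->
  rsum u = U%:E -> rsum v = V%:E ->
  rsum (fun ij : nat * nat => u ij.1 * v ij.2) = (U * V)%:E.
Proof.
move=> u0 v0 uU vV; rewrite rsum_pair; last by move=> ij; rewrite mulr_ge0.
have V0 : 0 <= V by rewrite -lee_fin -vV rsum_ge0.
under eq_esum do rewrite /= rsumZ// vV -EFinM mulrC.
by rewrite -/(rsum _) rsumZ// uU -EFinM mulrC.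
Qed.

End RealSums.

Section Marginals.
Context {R : realType}.
Implicit Types a b : nat * nat -> R.

Definition summable_arr a := (forall ij, 0 <= a ij) /\ (rsum a < +oo)%E.

Lemma summable_arrD a b : summable_arr a -> summable_arr b ->
  summable_arr (fun ij => a ij + b ij).
Proof.
move=> [a0 ay] [b0 b_y]; split; first by move=> ij; rewrite addr_ge0.
by rewrite rsumD// lte_add_pinfty.
Qed.

Lemma summable_arr_le a b : (forall ij, 0 <= a ij) ->
  (forall ij, a ij <= b ij) -> summable_arr b -> summable_arr a.
Proof.
by move=> a0 ab [_ b_y]; split => //; exact: le_lt_trans (le_rsum ab) b_y.
Qed.

Lemma summable_arr_swap a : summable_arr a -> summable_arr (swap_arr a).
Proof. by move=> [a0 ay]; split; [move=> ij; exact: a0|rewrite rsum_swap]. Qed.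

Lemma arr_mass_swap a : arr_mass (swap_arr a) = arr_mass a.
Proof. by rewrite /arr_mass -/(rsum _) rsum_swap. Qed.

Lemma arr_massE a : summable_arr a -> rsum a = (arr_mass a)%:E.
Proof.
by move=> [a0 ay]; rewrite /arr_mass fineK// ge0_fin_numE// rsum_ge0.
Qed.

Lemma arr_mass_ge0 a : summable_arr a -> 0 <= arr_mass a.
Proof. by move=> [a0 ay]; rewrite fine_ge0// rsum_ge0. Qed.

(** A row sum is at most the total, hence finite, so [fine] in [marg1] loses nothing. *)
Lemma marg1E a i : summable_arr a ->
  rsum (fun j => a (i, j)) = (marg1 a i)%:E.
Proof.
move=> [a0 ay]; rewrite /marg1 fineK// ge0_fin_numE ?rsum_ge0//.
apply: le_lt_trans ay; rewrite rsum_pair// -/(rsum _).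
apply: le_trans (_ : \esum_(k in [set i]) rsum (fun j => a (k, j)) <= _)%E.
  by rewrite esum_set1 ?rsum_ge0.
rewrite esum_mkcond; apply: le_esum => k _; case: ifP => // _.
by rewrite rsum_ge0.
Qed.

Lemma marg1_ge0 a i : summable_arr a -> 0 <= marg1 a i.
Proof. by move=> [a0 ay]; rewrite fine_ge0// rsum_ge0. Qed.

Lemma rsum_marg1 a : summable_arr a -> rsum (marg1 a) = (arr_mass a)%:E.
Proof.
move=> sa; rewrite -arr_massE// rsum_pair; last exact: sa.1.
by apply: eq_esum => i _; rewrite marg1E.
Qed.

Lemma le_marg1 a i j : summable_arr a -> a (i, j) <= marg1 a i.
Proof.
move=> sa; rewrite -lee_fin -marg1E//.
by apply: (@rsum_ge1 _ _ (fun j => a (i, j))) => k; exact: sa.1.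
Qed.

Lemma marg1_le_mass a i : summable_arr a -> marg1 a i <= arr_mass a.
Proof.
move=> sa; rewrite -lee_fin -rsum_marg1//.
by apply: rsum_ge1 => k; exact: marg1_ge0.
Qed.

Lemma le_mass a ij : summable_arr a -> a ij <= arr_mass a.
Proof.
by case: ij => i j sa; exact: le_trans (le_marg1 _ _ sa) (marg1_le_mass _ sa).
Qed.

Lemma marg1D a b i : summable_arr a -> summable_arr b ->
  marg1 (fun ij => a ij + b ij) i = marg1 a i + marg1 b i.
Proof.
move=> sa sb; have sab := summable_arrD sa sb.
apply: EFin_inj; rewrite -marg1E// EFinD -!marg1E// rsumD//.
- by move=> j; exact: sa.1.
- by move=> j; exact: sb.1.
Qed.

Lemma arr_massD a b : summable_arr a -> summable_arr b ->
  arr_mass (fun ij => a ij + b ij) = arr_mass a + arr_mass b.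
Proof.
move=> sa sb; have sab := summable_arrD sa sb.
apply: EFin_inj; rewrite -arr_massE// EFinD -!arr_massE// rsumD//.
- by move=> j; exact: sa.1.
- by move=> j; exact: sb.1.
Qed.

Lemma summable_arrZ c a : 0 <= c -> summable_arr a ->
  summable_arr (fun ij => c * a ij).
Proof.
move=> c0 sa; split; first by move=> ij; rewrite mulr_ge0// sa.1.
by rewrite rsumZ// arr_massE// -EFinM ltry.
Qed.

Lemma marg1Z c a i : 0 <= c -> summable_arr a ->
  marg1 (fun ij => c * a ij) i = c * marg1 a i.
Proof.
move=> c0 sa; apply: EFin_inj; rewrite -marg1E; last exact: summable_arrZ.
by rewrite rsumZ// marg1E.
Qed.

Lemma arr_massZ c a : 0 <= c -> summable_arr a ->
  arr_mass (fun ij => c * a ij) = c * arr_mass a.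
Proof.
move=> c0 sa; apply: EFin_inj; rewrite -arr_massE; last exact: summable_arrZ.
by rewrite rsumZ// arr_massE.
Qed.

Lemma marg2_swap a j : marg2 a j = marg1 (swap_arr a) j.
Proof. by []. Qed.

Lemma marg2_ge0 a j : summable_arr a -> 0 <= marg2 a j.
Proof. by move=> /summable_arr_swap; exact: marg1_ge0. Qed.

Lemma rsum_marg2 a : summable_arr a -> rsum (marg2 a) = (arr_mass a)%:E.
Proof.
by move=> sa; rewrite -arr_mass_swap -rsum_marg1//; exact: summable_arr_swap.
Qed.

Lemma le_marg2 a i j : summable_arr a -> a (i, j) <= marg2 a j.
Proof. by move=> /summable_arr_swap /(@le_marg1 _ j i). Qed.

Lemma marg2D a b j : summable_arr a -> summable_arr b ->
  marg2 (fun ij => a ij + b ij) j = marg2 a j + marg2 b j.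
Proof.
by move=> /summable_arr_swap sa /summable_arr_swap sb; rewrite !marg2_swap -marg1D.
Qed.

Lemma marg2Z c a j : 0 <= c -> summable_arr a ->
  marg2 (fun ij => c * a ij) j = c * marg2 a j.
Proof. by move=> c0 /summable_arr_swap sa; rewrite !marg2_swap -marg1Z. Qed.

Lemma rsum_prod_marg a : summable_arr a ->
  rsum (prod_marg a) = (arr_mass a * arr_mass a)%:E.
Proof.
move=> sa; apply: rsum_prod; rewrite ?rsum_marg1 ?rsum_marg2// => k.
- exact: marg1_ge0.
- exact: marg2_ge0.
Qed.

End Marginals.

(** * Logarithmic inequalities and information terms *)

Section Logarithm.
Context {R : realType}.
Implicit Types x y z w : R.

(** This is [ln t <= t - 1] at [t = y / x], multiplied by [x]. *)
Lemma mul_ln_le x y : 0 < x -> 0 < y -> x * ln (y / x) <= y - x.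
Proof.
move=> x0 y0; have yx0 : 0 < y / x by rewrite divr_gt0.
have : ln (y / x) <= y / x - 1.
  by rewrite -[X in ln X](subrKC 1) le_ln1Dx//; lra.
rewrite -(ler_pM2l x0) => /le_trans; apply.
by rewrite mulrBr mulr1 mulrCA divff ?gt_eqF// mulr1.
Qed.

Lemma ln_mulE x y : 0 < x -> 0 < y -> ln (x * y) = ln x + ln y.
Proof. by move=> x0 y0; rewrite lnM// posrE. Qed.

Lemma ln_divE x y : 0 < x -> 0 < y -> ln (x / y) = ln x - ln y.
Proof. by move=> x0 y0; rewrite ln_div// posrE. Qed.

Lemma ln_ratioE x y z w : 0 < x -> 0 < y -> 0 < z -> 0 < w ->
  ln (x * y / (z * w)) = ln x + ln y - ln z - ln w.
Proof.
by move=> *; rewrite ln_divE ?mulr_gt0// !ln_mulE// opprD addrA.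
Qed.

Lemma ler_ln_pos x y : 0 < x -> x <= y -> ln x <= ln y.
Proof. by move=> x0 xy; rewrite ler_ln ?posrE// (lt_le_trans x0). Qed.

(* (x + y) h2(x / (x + y)): junk values 1 / 0 = 0 and ln 0 = 0 make it vanish
   when x = 0 or y = 0. *)
Definition mix_entropy x y : R := x * ln ((x + y) / x) + y * ln ((x + y) / y).

Lemma mul_ln_ratio_ge0 x y : 0 <= x -> x <= y -> 0 <= x * ln (y / x).
Proof.
rewrite le_eqVlt => /predU1P[<-|x0 xy]; first by rewrite mul0r.
by apply: mulr_ge0; [exact: ltW|apply: ln_ge0; rewrite ler_pdivlMr// mul1r].
Qed.

Lemma mix_entropy_ge0 x y : 0 <= x -> 0 <= y -> 0 <= mix_entropy x y.
Proof.
by move=> x0 y0; rewrite addr_ge0// mul_ln_ratio_ge0// ?lerDl// lerDr.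
Qed.

(* Gibbs' inequality, with equality at t = x / (x + y). *)
Lemma mix_entropy_le x y t : 0 <= x -> 0 <= y -> 0 < t < 1 ->
  mix_entropy x y <= - (x * ln t) - y * ln (1 - t).
Proof.
move=> x0 y0 /andP[t0 t1].
have [s0|s0] := leP (x + y) 0.
  have -> : x = 0 by lra.
  have -> : y = 0 by lra.
  by rewrite /mix_entropy !mul0r; lra.
(* Used at [(x, t)] and [(y, 1 - t)]: the linear remainders then add up to [(x + y) - x - y = 0]. *)
have key (z u : R) : 0 <= z -> 0 < u ->
    z * ln ((x + y) / z) <= - (z * ln u) + (x + y) * u - z.
  rewrite le_eqVlt => /predU1P[<-|z0] u0.
    by rewrite !mul0r; have := mulr_ge0 (ltW s0) (ltW u0); lra.
  have := @mul_ln_le z ((x + y) * u) z0 (mulr_gt0 s0 u0).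
  rewrite !ln_divE ?mulr_gt0// ln_mulE//; lra.
have := key x t x0 t0.
have := key y (1 - t) y0; rewrite subr_gt0 => /(_ t1).
rewrite /mix_entropy; lra.
Qed.

(** The two logarithms differ by [ln (a / c) <= 0], by [ln (C / A)], and by the logarithms of the
    likelihood ratios [A c1 / (C a1)] and [A c2 / (C a2)] of the normalised marginals. Bounding each
    of the latter by [t - 1] produces the weights on the right and the [2 * a] on the left. *)
Lemma info_term_le_mixture (a a1 a2 A c c1 c2 C : R) :
  0 < a -> 0 < a1 -> 0 < a2 -> 0 < A -> 0 < c1 -> 0 < c2 -> 0 < C -> a <= c ->
  a * ln (a * A / (a1 * a2)) + 2 * a <=
    a * ln (c * C / (c1 * c2)) + A * c1 / (C * a1) * a + A * c2 / (C * a2) * a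
    + a * ln (C / A).
Proof.
move=> a0 a10 a20 A0 c10 c20 C0 ac; have c0 : 0 < c := lt_le_trans a0 ac.
have h1 : a * (ln A + ln c1 - ln C - ln a1) <= A * c1 / (C * a1) * a - a.
  have := @mul_ln_le a (A * c1 / (C * a1) * a) a0.
  rewrite mulfK ?gt_eqF// ln_ratioE//; apply.
  by rewrite mulr_gt0// divr_gt0// mulr_gt0.
have h2 : a * (ln A + ln c2 - ln C - ln a2) <= A * c2 / (C * a2) * a - a.
  have := @mul_ln_le a (A * c2 / (C * a2) * a) a0.
  rewrite mulfK ?gt_eqF// ln_ratioE//; apply.
  by rewrite mulr_gt0// divr_gt0// mulr_gt0.
have h3 : a * ln a <= a * ln c by rewrite ler_pM2l// ler_ln_pos.
rewrite !ln_ratioE// ln_divE//; lra.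
Qed.

(** Here the first marginal is dropped by [a1 <= c1]. What remains compares [a] with [c / c2 * a2],
    which has the column mass of [a] and the conditional law of [c] given the column. *)
Lemma mixture_term_le (a a1 a2 A c c1 c2 C : R) :
  0 < a -> 0 < a1 -> 0 < a2 -> 0 < A -> 0 < c -> 0 < c2 -> 0 < C -> a1 <= c1 ->
  a * ln (c * C / (c1 * c2)) + a <=
    a * ln (a * A / (a1 * a2)) + c / c2 * a2 + a * ln (C / A).
Proof.
move=> a0 a10 a20 A0 c0 c20 C0 a1c1; have c10 : 0 < c1 := lt_le_trans a10 a1c1.
have h1 : a * (ln c + ln a2 - ln c2 - ln a) <= c / c2 * a2 - a.
  have ca0 : 0 < c / c2 * a2 by rewrite mulr_gt0// divr_gt0.
  have := @mul_ln_le a (c / c2 * a2) a0 ca0.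
  rewrite ln_divE// ln_mulE ?divr_gt0// ln_divE//; lra.
have h2 : a * ln a1 <= a * ln c1 by rewrite ler_pM2l// ler_ln_pos.
rewrite !ln_ratioE// ln_divE//; lra.
Qed.

End Logarithm.

Section InformationTerms.
Context {R : realType}.
Implicit Types a b : nat * nat -> R.

(** The generalised Kullback-Leibler term [x ln (x / y) - x + y], with [x] the entry of [a] and [y]
    that of the product of its marginals rescaled to the mass of [a]. *)
Definition info_term a ij : R :=
  a ij * ln (a ij * arr_mass a / (marg1 a ij.1 * marg2 a ij.2))
  - a ij + prod_marg a ij / arr_mass a.

Definition info a : \bar R := rsum (info_term a).

Lemma prod_marg_ge0 a ij : summable_arr a -> 0 <= prod_marg a ij.
Proof. by move=> sa; rewrite mulr_ge0 ?marg1_ge0 ?marg2_ge0. Qed.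

Lemma prod_marg_mass_ge0 a ij : summable_arr a ->
  0 <= prod_marg a ij / arr_mass a.
Proof. by move=> sa; rewrite divr_ge0 ?prod_marg_ge0 ?arr_mass_ge0. Qed.

Lemma rsum_prod_marg_mass a : summable_arr a ->
  rsum (fun ij => prod_marg a ij / arr_mass a) = (arr_mass a)%:E.
Proof.
move=> sa; under eq_rsum do rewrite mulrC.
rewrite rsumZ ?invr_ge0 ?arr_mass_ge0// rsum_prod_marg// -EFinM.
by have [->|A0] := eqVneq (arr_mass a) 0; rewrite ?mulr0// mulKf.
Qed.

Lemma arr_pos a ij : summable_arr a -> 0 < a ij ->
  [/\ 0 < marg1 a ij.1, 0 < marg2 a ij.2 & 0 < arr_mass a].
Proof.
case: ij => i j sa a0; split => /=; apply: lt_le_trans a0 _.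
- exact: le_marg1.
- exact: le_marg2.
- exact: le_mass.
Qed.

Lemma arr_eq0_or_pos a ij : summable_arr a -> a ij = 0 \/ 0 < a ij.
Proof.
move=> sa; have := sa.1 ij; rewrite le_eqVlt => /predU1P[<-|]; first by left.
by right.
Qed.

Lemma info_term_ge0 a ij : summable_arr a -> 0 <= info_term a ij.
Proof.
move=> sa; rewrite /info_term; have [a0|a0] := arr_eq0_or_pos ij sa.
  by rewrite a0 !mul0r subrr add0r prod_marg_mass_ge0.
have [a1 a2 A] := arr_pos sa a0.
have := @mul_ln_le R (a ij) (prod_marg a ij / arr_mass a) a0.
rewrite divr_gt0 ?mulr_gt0// => /(_ isT).
rewrite ln_ratioE// ln_divE ?divr_gt0 ?mulr_gt0// ln_divE ?mulr_gt0//.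
rewrite ln_mulE//; lra.
Qed.

Lemma info_ge0 a : summable_arr a -> (0 <= info a)%E.
Proof. by move=> sa; apply: rsum_ge0 => ij; exact: info_term_ge0. Qed.

End InformationTerms.

(** * The homogeneous extension as a sum of nonnegative terms *)

Section HomogeneousExtension.
Context {R : realType}.
Implicit Types a p : nat * nat -> R.

(** Since [x] and [y] have the same finite total, inserting [- x t + y t] changes nothing in the
    sum, and it makes every term nonnegative. *)
Lemma DKL_rsum (T : choiceType) (x y : T -> R) (M : R) :
  (forall t, 0 <= x t) -> (forall t, 0 <= y t) ->
  (forall t, 0 < x t -> 0 < y t) -> rsum x = M%:E -> rsum y = M%:E ->
  DKL x y = rsum (fun t => x t * ln (x t / y t) - x t + y t).
Proof.
move=> x0 y0 xy xM yM; pose r t := x t * ln (x t / y t).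
have psi0 t : 0 <= r t - x t + y t.
  rewrite /r; have := x0 t; rewrite le_eqVlt => /predU1P[<-|xt0].
    by rewrite !mul0r subrr add0r.
  have yt0 := xy t xt0; have := mul_ln_le xt0 yt0.
  rewrite !ln_divE//; lra.
(* The value [+oo] of [kl_term] does not occur, as [y t] is positive wherever [x t] is. *)
have termE t : kl_term (x t) (y t) = (r t)%:E.
  rewrite /kl_term /r; case: eqVneq => [->|xt0]; first by rewrite mul0r.
  by rewrite gt_eqF// xy// lt0r xt0 x0.
have posE : (\esum_(t in setT) (fun t => kl_term (x t) (y t))^\+ t)%E
    = rsum (fun t => Num.max (r t) 0).
  by apply: eq_esum => t _; rewrite funeposE termE EFin_max.
have negE : (\esum_(t in setT) (fun t => kl_term (x t) (y t))^\- t)%E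
    = rsum (fun t => Num.max (- r t) 0).
  by apply: eq_esum => t _; rewrite funenegE termE -EFinN EFin_max.
rewrite /DKL posE negE.
have max0 (u : R) : 0 <= Num.max u 0 by rewrite le_max lexx orbT.
(* Nonnegativity of [r t - x t + y t] gives [- r t <= y t]. *)
have negy : (rsum (fun t => Num.max (- r t) 0)%R <= M%:E)%E.
  rewrite -yM; apply: le_rsum => t; rewrite ge_max y0 andbT.
  by have := psi0 t; have := x0 t; lra.
have negfin : rsum (fun t => Num.max (- r t) 0) \is a fin_num.
  by rewrite ge0_fin_numE ?rsum_ge0// (le_lt_trans negy)// ltry.
(* Only nonnegative families are added. The finite quantities [M] and the negative part are
   cancelled afterwards, which remains valid for an infinite divergence. *)
have balance : (rsum (fun t => r t - x t + y t)%R
    + (M%:E + rsum (fun t => Num.max (- r t) 0)%R)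
    = rsum (fun t => Num.max (r t) 0)%R + M%:E)%E.
  rewrite -{1}xM -yM -!rsumD//; last by move=> t; rewrite addr_ge0.
  apply: eq_rsum => t /=; rewrite /Num.max; case: ltP => h1; case: ltP => h2; lra.
move: balance; rewrite -(fineK negfin).
case: (rsum (fun t => r t - x t + y t)) => [u| |];
  case: (rsum (fun t => Num.max (r t) 0)) => [v| |] //= [] uv.
by congr (_%:E); lra.
Qed.

(** Normalising [a] gives total 1 to the array and to the product of its marginals, so [DKL_rsum]
    applies; multiplying by the mass then turns its terms into those of [info]. At mass 0 all terms
    vanish. *)
Lemma hext_mutual_info a : summable_arr a -> hext mutual_info a = info a.
Proof.
move=> sa; rewrite /hext; case: eqVneq => [mass0|A0].
  have marg10 i : marg1 a i = 0.
    by apply/eqP; rewrite eq_le marg1_ge0// -mass0 marg1_le_mass.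
  have a0 ij : a ij = 0 by apply/eqP; rewrite eq_le sa.1// -mass0 le_mass.
  rewrite /info (@eq_rsum _ _ _ (fun=> 0)) ?rsum0// => ij.
  by rewrite /info_term /prod_marg a0 marg10 !mul0r subrr addr0.
have {}A0 : 0 < arr_mass a by rewrite lt0r A0 arr_mass_ge0.
have Ai0 : 0 <= (arr_mass a)^-1 by rewrite invr_ge0 ltW.
pose x ij := (arr_mass a)^-1 * a ij.
have xE : (fun ij => a ij / arr_mass a) = x.
  by apply/funext => ij; rewrite mulrC.
have sx : summable_arr x by exact: summable_arrZ.
have massx : arr_mass x = 1 by rewrite arr_massZ// mulVf// gt_eqF.
rewrite xE /mutual_info (@DKL_rsum _ _ _ 1); last 5 first.
- exact: sx.1.
- by move=> ij; exact: prod_marg_ge0.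
- by move=> ij /(arr_pos sx)[*]; rewrite mulr_gt0.
- by rewrite arr_massE// massx.
- by rewrite rsum_prod_marg// massx mulr1.
rewrite -rsumZ ?ltW//; apply: eq_rsum => ij.
rewrite /info_term /prod_marg /x marg1Z// marg2Z//.
have [->|aij0] := arr_eq0_or_pos ij sa.
  by rewrite !mulr0 !mul0r; field; rewrite gt_eqF.
have [a1 a2 _] := arr_pos sa aij0.
rewrite [X in ln X](_ : _ = a ij * arr_mass a / (marg1 a ij.1 * marg2 a ij.2)).
  by field; rewrite gt_eqF.
by field; rewrite !gt_eqF.
Qed.

Lemma mutual_info_distr p : is_distr p ->
  [/\ summable_arr p, arr_mass p = 1 & mutual_info p = info p].
Proof.
move=> [p0 p1]; have sp : summable_arr p by split => //; rewrite /rsum p1 ltry.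
have mp : arr_mass p = 1 by rewrite /arr_mass p1.
split => //; rewrite -hext_mutual_info// /hext mp oner_eq0 mul1e.
by congr mutual_info; apply/funext => ij; rewrite divr1.
Qed.

End HomogeneousExtension.

(** * Almost additivity of the mutual information *)

Section Mixtures.
Context {R : realType}.
Implicit Types a b c : nat * nat -> R.

Lemma rsum_reweight1 (u : nat -> R) a : (forall i, 0 <= u i) -> summable_arr a ->
  rsum (fun ij => u ij.1 * a ij) = rsum (fun i => u i * marg1 a i).
Proof.
move=> u0 sa; rewrite rsum_pair; last by move=> ij; rewrite mulr_ge0// sa.1.
by apply: eq_esum => i _; rewrite /= rsumZ// marg1E// EFinM.
Qed.

Lemma rsum_reweight2 (u : nat -> R) a : (forall j, 0 <= u j) -> summable_arr a ->
  rsum (fun ij => u ij.2 * a ij) = rsum (fun j => u j * marg2 a j).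
Proof.
move=> u0 sa; rewrite -rsum_swap.
exact: (rsum_reweight1 u0 (summable_arr_swap sa)).
Qed.

(** Cancelling [v i] leaves [A / C * u i]. There is only an inequality because an index with
    [v i = 0] contributes 0 on the left, whatever [u i] is. *)
Lemma rsum_likelihood_le (u v : nat -> R) (A C : R) :
  (forall i, 0 <= u i) -> (forall i, 0 <= v i) -> 0 <= A -> 0 <= C ->
  rsum u = C%:E ->
  (rsum (fun i => A * u i / (C * v i) * v i)%R <= A%:E)%E.
Proof.
move=> u0 v0 A0 C0 uC.
apply: le_trans (_ : rsum (fun i => A / C * u i)%R <= _)%E.
  apply: le_rsum => i; rewrite invfM; have [->|vi] := eqVneq (v i) 0.
    by rewrite mulr0 mulr_ge0// divr_ge0.
  by rewrite mulrA mulfVK// mulrAC.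
rewrite rsumZ ?divr_ge0// uC -EFinM lee_fin.
by have [->|C1] := eqVneq C 0; rewrite ?mulr0// divfK.
Qed.

(** Sums a termwise inequality and cancels only the finite total [U], so that [f] and [g] may have
    infinite sums. *)
Lemma rsum_le_add (T : choiceType) (f g u v : T -> R) (U V : R) :
  (forall t, 0 <= f t) -> (forall t, 0 <= g t) ->
  (forall t, 0 <= u t) -> (forall t, 0 <= v t) ->
  (forall t, f t + u t <= g t + v t) ->
  rsum u = U%:E -> (rsum v <= (U + V)%:E)%E -> (rsum f <= rsum g + V%:E)%E.
Proof.
move=> f0 g0 u0 v0 /le_rsum; rewrite !rsumD// => fugv uU vUV.
move: fugv; rewrite uU => /le_trans/(_ (leeD2l _ vUV)).
by rewrite (addrC U) EFinD addeA leeD2rE.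
Qed.

Section two_arrays.
Variables a b c : nat * nat -> R.
Hypotheses (sa : summable_arr a) (sb : summable_arr b).
Hypothesis cE : forall ij, c ij = a ij + b ij.

Let c_fun : c = (fun ij => a ij + b ij).
Proof. by apply/funext. Qed.

Let sc : summable_arr c.
Proof. by rewrite c_fun; exact: summable_arrD. Qed.

Let A := arr_mass a.
Let B := arr_mass b.
Let C := arr_mass c.

(** For [d] one of the two parts of [c], [w1 d] and [w2 d] are [d] reweighted by the likelihood
    ratios of [info_term_le_mixture]; each totals at most the mass of [d]. The sum of [e d] is the
    share of [d] in the mixing entropy. *)
Let w1 (d : nat * nat -> R) ij :=
  arr_mass d * marg1 c ij.1 / (C * marg1 d ij.1) * d ij.
Let w2 (d : nat * nat -> R) ij :=
  arr_mass d * marg2 c ij.2 / (C * marg2 d ij.2) * d ij.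
Let e (d : nat * nat -> R) ij := d ij * ln (C / arr_mass d).
Let pm (d : nat * nat -> R) ij := prod_marg d ij / arr_mass d.
Let L ij := ln (c ij * C / (marg1 c ij.1 * marg2 c ij.2)).

Let w1_ge0 d ij : summable_arr d -> 0 <= w1 d ij.
Proof.
move=> sd; rewrite mulr_ge0 ?sd.1// divr_ge0// mulr_ge0//;
  by [exact: arr_mass_ge0|exact: marg1_ge0].
Qed.

Let w2_ge0 d ij : summable_arr d -> 0 <= w2 d ij.
Proof.
move=> sd; rewrite mulr_ge0 ?sd.1// divr_ge0// mulr_ge0//;
  by [exact: arr_mass_ge0|exact: marg2_ge0].
Qed.

Let rsum_w1 d : summable_arr d -> (rsum (w1 d) <= (arr_mass d)%:E)%E.
Proof.
move=> sd; rewrite /w1 (@rsum_reweight1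
  (fun i => arr_mass d * marg1 c i / (C * marg1 d i)))//; last first.
  move=> i; rewrite divr_ge0// mulr_ge0//;
    by [exact: arr_mass_ge0|exact: marg1_ge0].
apply: rsum_likelihood_le => [i|i|||];
  by [exact: marg1_ge0|exact: arr_mass_ge0|rewrite rsum_marg1].
Qed.

Let rsum_w2 d : summable_arr d -> (rsum (w2 d) <= (arr_mass d)%:E)%E.
Proof.
move=> sd; rewrite /w2 (@rsum_reweight2
  (fun i => arr_mass d * marg2 c i / (C * marg2 d i)))//; last first.
  move=> i; rewrite divr_ge0// mulr_ge0//;
    by [exact: arr_mass_ge0|exact: marg2_ge0].
apply: rsum_likelihood_le => [i|i|||];
  by [exact: marg2_ge0|exact: arr_mass_ge0|rewrite rsum_marg2].
Qed.

Let massC : C = A + B.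
Proof. by rewrite /C c_fun arr_massD. Qed.
Let A0 : 0 <= A. Proof. exact: arr_mass_ge0. Qed.
Let B0 : 0 <= B. Proof. exact: arr_mass_ge0. Qed.

Let ln_mass_ge0 (D : R) : 0 <= D -> D <= C -> 0 <= ln (C / D).
Proof.
(* At [D = 0] the defaults [0^-1 = 0] and [ln 0 = 0] make [ln (C / D)] vanish. *)
rewrite le_eqVlt => /predU1P[<- _|D0 DC]; first by rewrite invr0 mulr0 ln0.
by rewrite ln_ge0// ler_pdivlMr// mul1r.
Qed.

Let e_ge0 d ij : summable_arr d -> arr_mass d <= C -> 0 <= e d ij.
Proof. by move=> sd dC; rewrite mulr_ge0 ?sd.1// ln_mass_ge0// arr_mass_ge0. Qed.

Let rsum_e d : summable_arr d -> arr_mass d <= C ->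
  rsum (e d) = (arr_mass d * ln (C / arr_mass d))%:E.
Proof.
move=> sd dC; rewrite /e; under eq_rsum do rewrite mulrC.
by rewrite rsumZ ?ln_mass_ge0 ?arr_mass_ge0// arr_massE// -EFinM mulrC.
Qed.

Let AC : A <= C. Proof. by rewrite massC lerDl. Qed.
Let BC : B <= C. Proof. by rewrite massC lerDr. Qed.

Let rsum_ee : (rsum (e a) + rsum (e b) = (mix_entropy A B)%:E)%E.
Proof. by rewrite !rsum_e// -EFinD massC. Qed.

Let rsum_pm d : summable_arr d -> rsum (pm d) = (arr_mass d)%:E.
Proof. exact: rsum_prod_marg_mass. Qed.

Let info_term_le d ij : summable_arr d -> (forall ij, d ij <= c ij) ->
  info_term d ij + 3 * d ij <= d ij * L ij + w1 d ij + w2 d ij + e d ij + pm d ij.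
Proof.
move=> sd dc; rewrite /info_term.
have [d0|d0] := arr_eq0_or_pos ij sd.
  by rewrite /w1 /w2 /e d0 !(mul0r, mulr0) /pm; lra.
have [d1 d2 dm] := arr_pos sd d0.
have [c1 c2 cm] := arr_pos sc (lt_le_trans d0 (dc ij)).
have := info_term_le_mixture d0 d1 d2 dm c1 c2 cm (dc ij).
rewrite -/(L ij) -/(w1 d ij) -/(w2 d ij) -/(e d ij) /pm; lra.
Qed.

Let le_ac ij : a ij <= c ij. Proof. by rewrite cE lerDl sb.1. Qed.
Let le_bc ij : b ij <= c ij. Proof. by rewrite cE lerDr sa.1. Qed.

(** Add [info_term_le] for [a] and for [b], and write [c ij * L ij] as
    [info_term c ij + c ij - pm c ij]. The left side then carries an extra total [3 C]. On the right
    the two kinds of weights and the terms [pm] contribute at most [C] each, so that only the terms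
    [e] are left. *)
Lemma info_superadd : (info a + info b <= info c + (mix_entropy A B)%:E)%E.
Proof.
have ia := info_term_ge0 (a := a) ^~ sa; have ib := info_term_ge0 (a := b) ^~ sb.
have ic := info_term_ge0 (a := c) ^~ sc.
have pma ij : 0 <= pm a ij := prod_marg_mass_ge0 ij sa.
have pmb ij : 0 <= pm b ij := prod_marg_mass_ge0 ij sb.
have pmc ij : 0 <= pm c ij := prod_marg_mass_ge0 ij sc.
have wa1 ij := w1_ge0 ij sa; have wb1 ij := w1_ge0 ij sb.
have wa2 ij := w2_ge0 ij sa; have wb2 ij := w2_ge0 ij sb.
have ea ij := e_ge0 ij sa AC; have eb ij := e_ge0 ij sb BC.
rewrite /info -(@rsumD _ _ (info_term a) (info_term b))//.
apply: (@rsum_le_add _ _ _ (fun ij => c ij + (c ij + pm c ij))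
    (fun ij => (e a ij + e b ij)
      + ((w1 a ij + w1 b ij) + ((w2 a ij + w2 b ij) + (pm a ij + pm b ij))))
    (C + (C + C))) => [ij|//|ij|ij|ij||].
- by rewrite addr_ge0.
- by rewrite !addr_ge0// sc.1.
- by rewrite !addr_ge0.
- have := info_term_le ij sa le_ac; have := info_term_le ij sb le_bc.
  have -> : info_term c ij = c ij * L ij - c ij + pm c ij by [].
  rewrite cE; lra.
- rewrite !rsumD//; try by move=> ij; rewrite ?addr_ge0 ?sc.1.
  by rewrite (arr_massE sc) rsum_pm.
- rewrite !rsumD//; try by move=> ij; rewrite !addr_ge0.
  rewrite !rsum_pm// rsum_ee -/A -/B (addrC _ (mix_entropy A B)) (EFinD (mix_entropy A B)).
  rewrite leeD2lE//.
  rewrite massC 2!(EFinD (A + B)) !(EFinD A).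
  apply: leeD; first by apply: leeD; exact: rsum_w1.
  apply: leeD; last exact: lexx.
  by apply: leeD; exact: rsum_w2.
Qed.

Let mixture_le d ij : summable_arr d -> (forall ij, d ij <= c ij) ->
  d ij * L ij + pm d ij
    <= info_term d ij + marg2 d ij.2 / marg2 c ij.2 * c ij + e d ij.
Proof.
move=> sd dc; rewrite /info_term.
have [d0|d0] := arr_eq0_or_pos ij sd.
  rewrite /e d0 !mul0r subrr !add0r addr0 lerDl.
  by rewrite mulr_ge0 ?sc.1// divr_ge0 ?marg2_ge0.
have [d1 d2 dm] := arr_pos sd d0.
have c0 : 0 < c ij := lt_le_trans d0 (dc ij).
have [c1 c2 cm] := arr_pos sc c0.
have dc1 : marg1 d ij.1 <= marg1 c ij.1.
  rewrite -lee_fin -!marg1E//; apply: le_rsum => j; exact: dc.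
have := mixture_term_le d0 d1 d2 dm c0 c2 cm dc1.
rewrite -/(L ij) -/(e d ij) /pm mulrAC (mulrC (c ij)); lra.
Qed.

(** Add [mixture_le] for [a] and for [b]: the terms [pm a] and [pm b] together have the same total
    as [pm c], and only the terms [e] are left. *)
Lemma info_subadd : (info c <= info a + info b + (mix_entropy A B)%:E)%E.
Proof.
have ia := info_term_ge0 (a := a) ^~ sa; have ib := info_term_ge0 (a := b) ^~ sb.
have ic := info_term_ge0 (a := c) ^~ sc.
have pma ij : 0 <= pm a ij := prod_marg_mass_ge0 ij sa.
have pmb ij : 0 <= pm b ij := prod_marg_mass_ge0 ij sb.
have pmc ij : 0 <= pm c ij := prod_marg_mass_ge0 ij sc.
have ea ij := e_ge0 ij sa AC; have eb ij := e_ge0 ij sb BC.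
rewrite /info -(@rsumD _ _ (info_term a) (info_term b))//.
apply: (@rsum_le_add _ _ _ (fun ij => pm a ij + pm b ij)
    (fun ij => (e a ij + e b ij) + pm c ij) C)
  => [//|ij|ij|ij|ij||].
- by rewrite addr_ge0.
- by rewrite addr_ge0.
- by rewrite !addr_ge0.
- have := mixture_le ij sa le_ac; have := mixture_le ij sb le_bc.
  have -> : info_term c ij = c ij * L ij - c ij + pm c ij by [].
  (* The shares of [a] and [b] in a column of [c] add up to 1 unless the column is null, in which
     case [c ij = 0]. *)
  have : marg2 a ij.2 / marg2 c ij.2 * c ij + marg2 b ij.2 / marg2 c ij.2 * c ij
      = c ij.
    rewrite -mulrDl -mulrDl -marg2D// -c_fun.
    have [c0|c0] := arr_eq0_or_pos ij sc; first by rewrite c0 mulr0.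
    by have [_ c2 _] := arr_pos sc c0; rewrite divff ?mul1r ?gt_eqF.
  have := cE ij; set m := c ij; move=> mE.
  rewrite (_ : m * L ij = a ij * L ij + b ij * L ij); last by rewrite mE mulrDl.
  lra.
- by rewrite rsumD// !rsum_pm// -EFinD -massC.
- rewrite !rsumD//; try by move=> ij; rewrite !addr_ge0.
  by rewrite rsum_ee rsum_pm// -EFinD addrC.
Qed.

End two_arrays.
End Mixtures.

(** * Lower bounds at fixed eps *)

Section ErrorTerms.
Context {R : realType}.
Implicit Types x y e : R.

Lemma g_fun_mix_entropy e : 0 < e -> g_fun e = mix_entropy e 1.
Proof.
move=> e0; have e10 : 0 < e + 1 by rewrite addr_gt0.
by rewrite /g_fun e0 /mix_entropy !ln_divE// ln1; ring.
Qed.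

Lemma eta_mul_lnV x : 0 <= x -> eta x = x * ln (1 / x).
Proof.
rewrite /eta le_eqVlt => /predU1P[<-|x0]; first by rewrite ltxx mul0r.
by rewrite x0 ln_divE// ln1 sub0r mulrN.
Qed.

Lemma h2_mix_entropy x : 0 <= x <= 1 -> h2 x = mix_entropy x (1 - x).
Proof.
by move=> /andP[x0 x1]; rewrite /h2 !eta_mul_lnV ?subr_ge0// /mix_entropy subrKC.
Qed.

Lemma h2_onem x : h2 (1 - x) = h2 x.
Proof. by rewrite /h2 subKr addrC. Qed.

Lemma h2_ge0 x : 0 <= x <= 1 -> 0 <= h2 x.
Proof.
by move=> x01; rewrite h2_mix_entropy//; case/andP: x01 => *; rewrite mix_entropy_ge0 ?subr_ge0.
Qed.

Lemma h2t_ge0 e : 0 <= e <= 1 -> 0 <= h2t e.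
Proof.
by move=> e01; rewrite /h2t; case: ifP => _; [exact: h2_ge0|rewrite ln_ge0 ?ler1n].
Qed.

Lemma g_fun_ge0 e : 0 < e -> 0 <= g_fun e.
Proof. by move=> e0; rewrite g_fun_mix_entropy// mix_entropy_ge0// ltW. Qed.

(* The choice t = e / (e + 1) makes mix_entropy_le an equality at (e, 1). *)
Lemma mix_entropy1_le_g_fun x e : 0 <= x -> x <= e -> 0 < e -> mix_entropy x 1 <= g_fun e.
Proof.
move=> x0 xe e0; have e10 : 0 < e + 1 by rewrite addr_gt0.
have t01 : 0 < e / (e + 1) < 1.
  by rewrite divr_gt0//= ltr_pdivrMr// mul1r ltrDl.
have := mix_entropy_le x0 ler01 t01.
have -> : 1 - e / (e + 1) = 1 / (e + 1) by field; rewrite gt_eqF.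
rewrite /g_fun e0 !ln_divE// ln1 => /le_trans; apply.
have : ln e <= ln (e + 1) by rewrite ler_ln_pos// lerDl.
rewrite -subr_ge0 => ln_le; move: xe.
by rewrite -subr_ge0 => /mulr_ge0/(_ ln_le); lra.
Qed.

(** Gibbs' inequality with [t = e] if [e <= 1/2], where [ln e <= ln (1 - e)] makes the bound largest
    at [x = e], [y = 1 - e]; otherwise with [t = 1/2], giving [(x + y) ln 2]. *)
Lemma mix_entropy_le_h2t x y e : 0 <= x -> 0 <= y -> x <= e -> x + y <= 1 -> 0 < e ->
  mix_entropy x y <= h2t e.
Proof.
move=> x0 y0 xe xy1 e0; rewrite /h2t; case: ifPn => [e2|].
  have ne0 : 0 < 1 - e by lra.
  have e01 : 0 < e < 1 by apply/andP; split; lra.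
  apply: le_trans (mix_entropy_le x0 y0 e01) _.
  rewrite /h2 /eta e0 ne0.
  have ln_le : ln e <= ln (1 - e) by rewrite ler_ln_pos//; lra.
  have ln0 : ln (1 - e) <= 0 by rewrite ln_le0//; lra.
  have h1 : (e - x) * ln e <= (e - x) * ln (1 - e) by rewrite ler_wpM2l// subr_ge0.
  have h2 : (1 - x - y) * ln (1 - e) <= 0.
    by rewrite mulr_ge0_le0//; lra.
  lra.
rewrite -ltNge => e2.
have h01 : 0 < (2^-1 : R) < 1 by apply/andP; split; lra.
apply: le_trans (mix_entropy_le x0 y0 h01) _.
have -> : 1 - 2^-1 = 2^-1 :> R by field.
rewrite -[2^-1]mul1r ln_divE// ln1 sub0r.
have : 0 <= ln (2 : R) by rewrite ln_ge0// ler1n.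
rewrite -subr_ge0 in xy1.
by move=> /(mulr_ge0 xy1); lra.
Qed.

End ErrorTerms.

(** * Excess and truncated arrays, and comparison with a nearby distribution *)

Section LowerBounds.
Context {R : realType}.
Implicit Types a b p q : nat * nat -> R.

(** Superadditivity for [b = a + (b - a)], with the nonnegative information of [b - a] dropped. *)
Lemma info_le a b : summable_arr b -> (forall ij, 0 <= a ij) ->
  (forall ij, a ij <= b ij) ->
  (info a <= info b + (mix_entropy (arr_mass a) (arr_mass b - arr_mass a))%:E)%E.
Proof.
move=> sb a0 ab; have sa := summable_arr_le a0 ab sb.
pose d ij := b ij - a ij.
have sd : summable_arr d.
  by apply: summable_arr_le sb => ij; rewrite /d ?subr_ge0// gerBl.
have bE ij : b ij = a ij + d ij by rewrite /d subrKC.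
have -> : arr_mass b - arr_mass a = arr_mass d.
  have -> : arr_mass b = arr_mass a + arr_mass d.
    by rewrite -arr_massD//; congr arr_mass; apply/funext.
  by rewrite addrC addKr.
by apply: le_trans (info_superadd sa sd bE); rewrite leeDl// info_ge0.
Qed.

Lemma excess_trunc p eps ij : p ij = excess_arr p eps ij + trunc_arr p eps ij.
Proof. by rewrite /excess_arr /trunc_arr /Num.max /Num.min; do 2 case: ltP => ?; lra. Qed.

Lemma excess_ge0 p eps ij : 0 <= excess_arr p eps ij.
Proof. by rewrite le_max lexx orbT. Qed.

Lemma trunc_ge0 p eps ij : (forall ij, 0 <= p ij) -> 0 <= eps ->
  0 <= trunc_arr p eps ij.
Proof. by move=> p0 e0; rewrite le_min p0. Qed.

Lemma summable_excess p eps : summable_arr p -> 0 <= eps ->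
  summable_arr (excess_arr p eps).
Proof.
move=> sp e0; apply: (summable_arr_le _ _ sp) => ij; first exact: excess_ge0.
by rewrite [leRHS](excess_trunc p eps) lerDl trunc_ge0//; exact: sp.1.
Qed.

Lemma summable_trunc p eps : summable_arr p -> 0 <= eps ->
  summable_arr (trunc_arr p eps).
Proof.
move=> sp e0; apply: (summable_arr_le _ _ sp) => ij; first by apply: trunc_ge0 => //; exact: sp.1.
by rewrite [leRHS](excess_trunc p eps) lerDr excess_ge0.
Qed.

Lemma arr_mass_excess_trunc p eps : summable_arr p -> 0 <= eps ->
  arr_mass p = arr_mass (excess_arr p eps) + arr_mass (trunc_arr p eps).
Proof.
move=> sp e0; rewrite -arr_massD; [|exact: summable_excess|exact: summable_trunc].
by congr arr_mass; apply/funext => ij; exact: excess_trunc.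
Qed.

(** The positive part of [p - q], as an excess over level 0 so that [excess_ge0] applies. *)
Definition pos_diff p q : nat * nat -> R := excess_arr (fun ij => p ij - q ij) 0.

Lemma pos_diffE p q ij : p ij + pos_diff q p ij = q ij + pos_diff p q ij.
Proof. by rewrite /pos_diff /excess_arr /Num.max /=; do 2 case: ltP => ?; lra. Qed.

Lemma pos_diff_le p q ij : (forall ij, 0 <= q ij) -> 0 <= p ij ->
  pos_diff p q ij <= p ij.
Proof.
move=> q0 p0; rewrite /pos_diff /excess_arr /Num.max /=; have := q0 ij.
by case: ltP => ?; lra.
Qed.

(** Both distributions have mass 1, so the positive and negative parts of [p - q] have equal masses,
    and the total variation distance is this common mass. *)
Lemma pos_diff_spec p q eps : is_distr p -> is_distr q ->
  (TVdist p q <= eps%:E)%E ->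
  [/\ summable_arr (pos_diff p q), summable_arr (pos_diff q p),
      arr_mass (pos_diff q p) = arr_mass (pos_diff p q) &
      arr_mass (pos_diff p q) <= eps].
Proof.
move=> dp dq tv.
have [sp p1 _] := mutual_info_distr dp; have [sq q1 _] := mutual_info_distr dq.
have su : summable_arr (pos_diff p q).
  apply: (summable_arr_le _ _ sp) => ij; first exact: excess_ge0.
  by apply: pos_diff_le dq.1 (dp.1 ij).
have sv : summable_arr (pos_diff q p).
  apply: (summable_arr_le _ _ sq) => ij; first exact: excess_ge0.
  by apply: pos_diff_le dp.1 (dq.1 ij).
have uv : arr_mass (pos_diff q p) = arr_mass (pos_diff p q).
  apply: (@addrI _ 1); rewrite -{1}p1 -q1 -!arr_massD//.
  by congr arr_mass; apply/funext => ij; exact: pos_diffE.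
split => //; move: tv; rewrite /TVdist.
rewrite (_ : \esum_(ij in setT) _ = rsum (fun ij => pos_diff p q ij + pos_diff q p ij)).
  rewrite rsumD; [|exact: su.1|exact: sv.1].
  by rewrite !arr_massE// uv -EFinD -EFinM lee_fin; lra.
apply: eq_esum => ij _; congr _%:E.
rewrite /pos_diff /excess_arr /Num.max /=.
by case: (ger0P (p ij - q ij)) => ?; do 2 case: ltP => ?; lra.
Qed.

(** An entry of [pos_diff p q] is at most its mass, so the bound on the distance yields
    [p ij - eps <= q ij], and [info_le] applies. *)
Lemma info_excess_le p q eps : is_distr p -> is_distr q ->
  0 < eps -> (TVdist p q <= eps%:E)%E ->
  (info (excess_arr p eps)
    <= info q + (h2 (1 - arr_mass (excess_arr p eps)))%:E)%E.
Proof.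
move=> dp dq e0 tv; have [su sv uv ue] := pos_diff_spec dp dq tv.
have [sq q1 _] := mutual_info_distr dq; have [sp p1 _] := mutual_info_distr dp.
have se := summable_excess sp (ltW e0).
have st := summable_trunc sp (ltW e0).
have xq ij : excess_arr p eps ij <= q ij.
  rewrite ge_max dq.1 andbT.
  have := le_mass ij su; have := pos_diffE p q ij.
  by have := sv.1 ij; lra.
apply: le_trans (info_le sq (@excess_ge0 _ _) xq) _.
rewrite h2_onem q1 h2_mix_entropy// arr_mass_ge0//= -p1.
by rewrite (arr_mass_excess_trunc sp (ltW e0)) lerDl arr_mass_ge0.
Qed.

(** One [g_fun eps] pays for superadditivity in [v + p], the other for subadditivity in [u + q];
    [h2t eps] pays for passing from [u], of mass at most [eps], to the truncated array, of mass at
    most 1. *)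
Lemma info_le_trunc p q eps : is_distr p -> is_distr q ->
  0 < eps -> (TVdist p q <= eps%:E)%E ->
  (info p <= info q + info (trunc_arr p eps) + (2 * g_fun eps + h2t eps)%:E)%E.
Proof.
move=> dp dq e0 tv; have [su sv uv ue] := pos_diff_spec dp dq tv.
have [sq q1 _] := mutual_info_distr dq; have [sp p1 _] := mutual_info_distr dp.
have st := summable_trunc sp (ltW e0).
set u := pos_diff p q in su uv ue *; set v := pos_diff q p in sv uv *.
(* This is the pointwise maximum of [p] and [q]. *)
pose s ij := v ij + p ij.
have sE ij : s ij = u ij + q ij.
  by rewrite /s addrC [RHS]addrC pos_diffE.
have ps := @info_superadd _ v p s sv sp (fun=> erefl).
have sqle := @info_subadd _ u q s su sq sE.
have Fg : mix_entropy (arr_mass u) 1 <= g_fun eps.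
  by apply: mix_entropy1_le_g_fun => //; exact: arr_mass_ge0.
have ut : (info u <= info (trunc_arr p eps) + (h2t eps)%:E)%E.
  apply: le_trans (info_le st su.1 _) _ => [ij|].
    rewrite le_min pos_diff_le ?dp.1//; last exact: dq.1.
    exact: le_trans (le_mass ij su) ue.
  have tp : arr_mass (trunc_arr p eps) <= 1.
    by rewrite -p1 (arr_mass_excess_trunc sp (ltW e0)) lerDr arr_mass_ge0//;
      exact: summable_excess (ltW e0).
  rewrite leeD2l// lee_fin mix_entropy_le_h2t ?arr_mass_ge0//; last by rewrite subrKC.
  rewrite subr_ge0 -lee_fin -!arr_massE//; apply: le_rsum => ij.
  rewrite le_min pos_diff_le ?dp.1//; last exact: dq.1.
  exact: le_trans (le_mass ij su) ue.
rewrite p1 uv in ps; rewrite q1 in sqle.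
have : (info p <= info v + info p)%E by rewrite leeDr// info_ge0.
move=> /le_trans/(_ ps)/le_trans; apply.
apply: le_trans (leeD2r _ sqle) _.
apply: le_trans (_ : info (trunc_arr p eps) + (h2t eps)%:E + info q
  + (g_fun eps)%:E + (g_fun eps)%:E <= _)%E.
  by rewrite !leeD// lee_fin.
case: (info q) => [x| |]; case: (info (trunc_arr p eps)) => [y| |] //=.
by rewrite lee_fin; lra.
Qed.

End LowerBounds.

(** * Limits as eps tends to 0 *)

Section ErrorLimits.
Context {R : realType}.

(** For [x > 0] and [s = sqrt x], [eta x = 2 s * (s ln (1 / s)) <= 2 s (1 - s)]. *)
Lemma eta_le_sqrt (x : R) : 0 <= x -> eta x <= 2 * Num.sqrt x.
Proof.
move=> x0; rewrite eta_mul_lnV//; move: x0; rewrite le_eqVlt => /predU1P[<-|x0].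
  by rewrite mul0r mulr_ge0// sqrtr_ge0.
have s0 : 0 < Num.sqrt x by rewrite sqrtr_gt0.
have xE : x = Num.sqrt x * Num.sqrt x by rewrite -expr2 sqr_sqrtr// ltW.
move: (Num.sqrt x) s0 xE => s s0 ->; rewrite ln_divE ?mulr_gt0// ln_mulE// ln1.
have := mul_ln_le s0 (@ltr01 R); rewrite ln_divE// ln1.
by rewrite -(ler_pM2l s0) => h; have := mulr_ge0 (ltW s0) (ltW s0); lra.
Qed.

Lemma h2_le (x : R) : 0 <= x <= 1 -> h2 x <= 2 * Num.sqrt x + x.
Proof.
move=> /andP[x0 x1]; rewrite /h2 lerD ?eta_le_sqrt//.
have y0 : 0 <= 1 - x by rewrite subr_ge0.
rewrite eta_mul_lnV//; have [->|yN0] := eqVneq (1 - x) 0; first by rewrite mul0r.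
have {y0}y0 : 0 < 1 - x by rewrite lt0r yN0.
by have := mul_ln_le y0 ltr01; lra.
Qed.

Lemma g_fun_le (x : R) : 0 < x -> g_fun x <= 2 * Num.sqrt x + (x + 1) * x.
Proof.
move=> x0; have := eta_le_sqrt (ltW x0); rewrite /eta /g_fun x0 => h.
have ln_le : ln (x + 1) <= x by rewrite addrC le_ln1Dx//; lra.
have x1 : 0 <= x + 1 by lra.
by have := ler_wpM2l x1 ln_le; lra.
Qed.

Lemma sqrt_cvg0 (F : set_system R) (f : R -> R) : Filter F ->
  f x @[x --> F] --> 0 -> 2 * Num.sqrt (f x) @[x --> F] --> 0.
Proof.
move=> FF f0; rewrite -[X in _ --> X](mulr0 2); apply: cvgMr.
rewrite -[X in _ --> X](sqrtr0 R).
exact: (continuous_cvg _ (@sqrt_continuous R 0) f0).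
Qed.

(** Stated for a family [f] to serve both for [eps] itself, in [h2t], and for the mass lost by the
    excess array. *)
Lemma h2_cvg0 (F : set_system R) (f : R -> R) : Filter F ->
  (\forall x \near F, 0 <= f x <= 1) ->
  f x @[x --> F] --> 0 -> h2 (f x) @[x --> F] --> 0.
Proof.
move=> FF f01 f0.
apply: (@squeeze_cvgr _ _ _ _ (fun=> 0) (fun x => 2 * Num.sqrt (f x) + f x)).
- by near=> x; rewrite h2_ge0 ?h2_le//; near: x.
- exact: cvg_cst.
- by rewrite -[X in _ --> X](addr0 0); apply: cvgD => //; exact: sqrt_cvg0.
Unshelve. all: by end_near. Qed.

Lemma h2t_cvg0 : h2t x @[x --> 0^'+] --> (0 : R).
Proof.
have id0 : (x : R) @[x --> 0^'+] --> (0 : R).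
  by apply: cvg_at_right_filter; exact: cvg_id.
have near01 : \forall x \near (0 : R)^'+, 0 <= x <= 1.
  by near=> x; apply/andP; split; near: x; [exact: nbhs_right_ge|exact: nbhs_right_le].
apply: cvg_trans (h2_cvg0 _ near01 id0); apply: near_eq_cvg.
near=> x; rewrite /h2t ifT//.
by near: x; apply: nbhs_right_le; lra.
Unshelve. all: by end_near. Qed.

Lemma g_fun_cvg0 : g_fun x @[x --> 0^'+] --> (0 : R).
Proof.
have id0 : (x : R) @[x --> 0^'+] --> (0 : R).
  by apply: cvg_at_right_filter; exact: cvg_id.
apply: (@squeeze_cvgr _ _ _ _ (fun=> 0) (fun x => 2 * Num.sqrt x + (x + 1) * x)).
- near=> x; have x0 : 0 < x by near: x; exact: nbhs_right_gt.
  by rewrite g_fun_ge0 ?g_fun_le.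
- exact: cvg_cst.
- rewrite -[X in _ --> X](addr0 0); apply: cvgD; first exact: sqrt_cvg0.
  rewrite -[X in _ --> X](mulr0 (0 + 1)); apply: cvgM => //.
  by apply: cvgD => //; exact: cvg_cst.
Unshelve. all: by end_near. Qed.

End ErrorLimits.

(** * Lower semicontinuity of the information along the excess arrays *)

Section Semicontinuity.
Context {R : realType}.
Implicit Types (F : set_system R) (p : nat * nat -> R).

(** Fatou's lemma for sums: some finite subsum of [g] already exceeds [M], and the corresponding
    subsums of [f e] converge to it. *)
Lemma rsum_lsc (T : choiceType) F (f : R -> T -> R) (g : T -> R) (M : R) :
  Filter F -> (\forall e \near F, forall t, 0 <= f e t) ->
  (forall t, f e t @[e --> F] --> g t) ->
  (M%:E < rsum g)%E -> \forall e \near F, (M%:E < rsum (f e))%E.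
Proof.
move=> FF f0 fg /ereal_sup_gt[_ [X [finX _] <-]].
rewrite fsbig_finite// sumEFin lte_fin; set r := finmap.enum_fset _ => MX.
have sumX : \sum_(t <- r) f e t @[e --> F] --> \sum_(t <- r) g t.
  by apply: cvg_big => [|t _]; [exact: add_continuous|exact: fg].
apply: filterS2 f0 (@cvgr_gt _ _ _ _ _ _ sumX M MX) => e fe0 MfX.
apply: lt_le_trans (_ : (\sum_(t <- r) f e t)%:E <= _)%E.
  by rewrite lte_fin.
by apply: esum_ge; exists X => //; rewrite fsbig_finite// sumEFin.
Qed.

Lemma ereal_cvg_below F (f : R -> \bar R) (L : \bar R) : ProperFilter F ->
  (0 <= L)%E -> (\forall e \near F, (f e <= L)%E) ->
  (forall M : R, (M%:E < L)%E -> \forall e \near F, (M%:E < f e)%E) ->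
  f e @[e --> F] --> L.
Proof.
(* The hypothesis [0 <= L] discards [-oo]; for [+oo] the lower estimates alone give convergence. *)
move=> FF; case: L => [r| |//] _ fL Mf; last first.
  by apply/cvgeyPgt => A; apply: Mf; rewrite ltry.
have near_r (d : R) : 0 < d ->
    \forall e \near F, f e \is a fin_num /\ r - d < fine (f e) <= r.
  move=> d0; have /Mf rd : ((r - d)%:E < r%:E)%E by rewrite lte_fin; lra.
  by apply: filterS2 fL rd => e; case: (f e) => [y| |] //=; rewrite lte_fin lee_fin => -> ->.
apply/fine_cvgP; split; first by apply: filterS (near_r _ ltr01) => e [].
apply/cvgrPdist_le => d d0; apply: filterS (near_r d d0) => e /= [_ /andP[h1 h2]].
by rewrite ger0_norm; lra.
Qed.

Section excess_limits.
Variable p : nat * nat -> R.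
Hypothesis sp : summable_arr p.

Let near_gt0 : \forall e \near (0 : R)^'+, 0 < e.
Proof. exact: nbhs_right_gt. Qed.

Lemma excess_cvg ij : excess_arr p e ij @[e --> 0^'+] --> p ij.
Proof.
have pe : p ij - e @[e --> (0 : R)^'+] --> p ij - 0.
  by apply: cvgB; [exact: cvg_cst|apply: cvg_at_right_filter; exact: cvg_id].
rewrite subr0 in pe; apply: squeeze_cvgr pe (cvg_cst (p ij)).
apply: filterS near_gt0 => e e0; rewrite /excess_arr le_max lexx/=.
by rewrite ge_max sp.1 andbT; lra.
Qed.

(** Semicontinuity gives the lower estimate, and the mass never exceeds that of [p]. *)
Lemma arr_mass_excess_cvg : arr_mass (excess_arr p e) @[e --> 0^'+] --> arr_mass p.
Proof.
apply/cvgrPdist_le => d d0.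
have massd : ((arr_mass p - d)%:E < rsum p)%E by rewrite arr_massE// lte_fin; lra.
have near_mass : \forall e \near 0^'+,
    ((arr_mass p - d)%:E < rsum (excess_arr p e))%E.
  apply: rsum_lsc massd; last exact: excess_cvg.
  by apply: nearW => e ij; exact: excess_ge0.
apply: filterS2 near_gt0 near_mass => e e0.
rewrite arr_massE ?lte_fin; last exact: summable_excess (ltW e0).
have := arr_mass_excess_trunc sp (ltW e0).
have := arr_mass_ge0 (summable_trunc sp (ltW e0)).
by move=> *; rewrite ger0_norm; lra.
Qed.

(** The loss in one row is at most the loss of total mass, which tends to 0. *)
Lemma marg1_excess_cvg i : marg1 (excess_arr p e) i @[e --> 0^'+] --> marg1 p i.
Proof.
have lo : marg1 p i - (arr_mass p - arr_mass (excess_arr p e)) @[e --> 0^'+]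
    --> marg1 p i - (arr_mass p - arr_mass p).
  apply: cvgB; first exact: cvg_cst.
  by apply: cvgB; [exact: cvg_cst|exact: arr_mass_excess_cvg].
rewrite subrr subr0 in lo; apply: squeeze_cvgr lo (cvg_cst (marg1 p i)).
apply: filterS near_gt0 => e e0.
have se := summable_excess sp (ltW e0); have st := summable_trunc sp (ltW e0).
have -> : marg1 p i = marg1 (excess_arr p e) i + marg1 (trunc_arr p e) i.
  rewrite -marg1D//; congr (marg1 _ i); apply/funext => ij.
  exact: excess_trunc.
have := marg1_ge0 i st; have := marg1_le_mass i st.
by rewrite (arr_mass_excess_trunc sp (ltW e0)) => *; apply/andP; split; lra.
Qed.

End excess_limits.

Lemma marg2_excess_cvg p j : summable_arr p ->
  marg2 (excess_arr p e) j @[e --> 0^'+] --> marg2 p j.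
Proof. by move=> /summable_arr_swap sp; exact: (@marg1_excess_cvg (swap_arr p)). Qed.

Lemma info_term_excess_cvg p ij : summable_arr p -> 0 < arr_mass p ->
  info_term (excess_arr p e) ij @[e --> 0^'+] --> info_term p ij.
Proof.
move=> sp p0; have mass_cvg := arr_mass_excess_cvg sp.
have prod_cvg : prod_marg (excess_arr p e) ij / arr_mass (excess_arr p e) @[e --> 0^'+]
    --> prod_marg p ij / arr_mass p.
  apply: cvgM; last by apply: cvgV => //; rewrite gt_eqF.
  by apply: cvgM; [exact: marg1_excess_cvg|exact: marg2_excess_cvg].
apply: cvgD => //; apply: cvgB; last exact: excess_cvg.
have [pij0|pij0] := arr_eq0_or_pos ij sp.
  rewrite pij0 mul0r; apply: cvg_near_cst; near=> e.
  rewrite /excess_arr pij0 (_ : Num.max _ _ = 0) ?mul0r//; apply/max_idPr.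
  by rewrite sub0r oppr_le0.
have [p1 p2 _] := arr_pos sp pij0.
apply: cvgM; first exact: excess_cvg.
have ratio0 : 0 < p ij * arr_mass p / (marg1 p ij.1 * marg2 p ij.2).
  by rewrite divr_gt0// mulr_gt0.
apply: (continuous_cvg _ (continuous_ln ratio0)).
apply: cvgM; first by apply: cvgM => //; exact: excess_cvg.
apply: cvgV; first by rewrite gt_eqF// mulr_gt0.
by apply: cvgM; [exact: marg1_excess_cvg|exact: marg2_excess_cvg].
Unshelve. all: by end_near. Qed.

Lemma info_excess_lsc p (M : R) : summable_arr p -> 0 < arr_mass p ->
  (M%:E < info p)%E -> \forall e \near 0^'+, (M%:E < info (excess_arr p e))%E.
Proof.
move=> sp p0; apply: rsum_lsc => [|ij]; last exact: info_term_excess_cvg.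
by near=> e => ij; apply: info_term_ge0; exact: summable_excess.
Unshelve. all: by end_near. Qed.

End Semicontinuity.

(** * The two bounds on the lower envelope and their limits *)

Section Proposition9.
Context {R : realType}.
Variable p : nat * nat -> R.
Hypothesis dp : is_distr p.

Let sp : summable_arr p. Proof. by case: (mutual_info_distr dp). Qed.
Let mass1 : arr_mass p = 1. Proof. by case: (mutual_info_distr dp). Qed.
Let miE : mutual_info p = info p. Proof. by case: (mutual_info_distr dp). Qed.

Lemma lower_env_ge (c : \bar R) (eps : R) :
  (forall q, is_distr q -> (TVdist p q <= eps%:E)%E -> (c <= info q)%E) ->
  (c <= lower_env mutual_info p eps)%E.
Proof.
move=> cq; apply: le_ereal_inf_tmp => _ [q [dq tv] <-].
by have [_ _ ->] := mutual_info_distr dq; exact: cq.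
Qed.

Lemma lower_env_le (eps : R) : 0 <= eps ->
  (lower_env mutual_info p eps <= mutual_info p)%E.
Proof.
move=> e0; apply: ereal_inf_lbound; exists p => //; split => //.
rewrite /TVdist esum1 ?mule0 ?lee_fin// => ij _.
by rewrite subrr normr0.
Qed.

Lemma arr_mass_excess01 (eps : R) : 0 < eps ->
  0 <= 1 - arr_mass (excess_arr p eps) <= 1.
Proof.
move=> e0; have := arr_mass_excess_trunc sp (ltW e0); rewrite mass1 => ->.
have := arr_mass_ge0 (summable_excess sp (ltW e0)).
have := arr_mass_ge0 (summable_trunc sp (ltW e0)).
by move=> *; apply/andP; split; lra.
Qed.

Definition excess_rhs (eps : R) : \bar R :=
  (hext mutual_info (excess_arr p eps) - (2 * g_fun eps)%:E - (h2t eps)%:E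
    - (h2 (1 - arr_mass (excess_arr p eps)))%:E)%E.

Definition trunc_rhs (eps : R) : \bar R :=
  (mutual_info p - hext mutual_info (trunc_arr p eps)
    - (2 * g_fun eps)%:E - (h2t eps)%:E)%E.

Lemma excess_rhs_le_lower_env (eps : R) : 0 < eps -> eps <= 1 ->
  (excess_rhs eps <= lower_env mutual_info p eps)%E.
Proof.
move=> e0 e1; apply: lower_env_ge => q dq tv.
rewrite /excess_rhs hext_mutual_info; last exact: summable_excess (ltW e0).
rewrite leeBlDr//; apply: le_trans (info_excess_le dp dq e0 tv).
have g0 := g_fun_ge0 e0; have h0 : 0 <= h2t eps by rewrite h2t_ge0// ltW.
by rewrite -addeA -oppeD// -EFinD leeBlDr// leeDl// lee_fin; lra.
Qed.

Lemma trunc_rhs_le_lower_env (eps : R) : (mutual_info p < +oo)%E ->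
  0 < eps -> eps <= 1 -> (trunc_rhs eps <= lower_env mutual_info p eps)%E.
Proof.
rewrite /trunc_rhs miE => py e0 e1; apply: lower_env_ge => q dq tv.
have st := summable_trunc sp (ltW e0); rewrite hext_mutual_info//.
have := info_le_trunc dp dq e0 tv; rewrite EFinD.
move: py (info_ge0 sp) (info_ge0 st).
case: (info p) => [x| |] //; case: (info (trunc_arr p eps)) => [y| |] //= _ _ _.
- by case: (info q) => [z| |] //=; rewrite ?leey// !lee_fin; lra.
(* If the truncated array has infinite information, the bound is [-oo]. *)
- by rewrite leNye.
Qed.

(** The excess and truncated arrays have masses [r] and [1 - r], so the error of superadditivity is
    exactly the term [h2 (1 - r)] of the first bound. *)
Lemma excess_rhs_le_trunc_rhs (eps : R) : (mutual_info p < +oo)%E -> 0 < eps ->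
  (excess_rhs eps <= trunc_rhs eps)%E.
Proof.
rewrite /excess_rhs /trunc_rhs miE => py e0.
have st := summable_trunc sp (ltW e0); have se := summable_excess sp (ltW e0).
rewrite !hext_mutual_info//.
have := info_superadd se st (excess_trunc p eps).
have -> : arr_mass (trunc_arr p eps) = 1 - arr_mass (excess_arr p eps).
  by rewrite -mass1 (arr_mass_excess_trunc sp (ltW e0)) addrC addKr.
rewrite -h2_mix_entropy ?h2_onem; last first.
  by have /andP[h1 h2] := arr_mass_excess01 e0; apply/andP; split; lra.
move: py (info_ge0 sp) (info_ge0 st) (info_ge0 se).
case: (info p) => [x| |] //; case: (info (trunc_arr p eps)) => [y| |] //= _ _ _;
  case: (info (excess_arr p eps)) => [z| |] //=; rewrite ?lee_fin.
by lra.
Qed.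

Lemma excess_rhs_cvg : excess_rhs eps @[eps --> 0^'+] --> mutual_info p.
Proof.
have near_le1 : \forall e \near (0 : R)^'+, 0 < e <= 1.
  by near=> e; apply/andP; split; near: e; [exact: nbhs_right_gt|exact: nbhs_right_le].
apply: ereal_cvg_below; first by rewrite miE info_ge0.
  apply: filterS near_le1 => e /andP[e0 e1].
  exact: le_trans (excess_rhs_le_lower_env e0 e1) (lower_env_le (ltW e0)).
move=> M; rewrite miE => Mp.
pose err (e : R) := 2 * g_fun e + h2t e + h2 (1 - arr_mass (excess_arr p e)).
have err0 : err e @[e --> 0^'+] --> 0.
  rewrite -[X in _ --> X](addr0 0); apply: cvgD.
    rewrite -[X in _ --> X](addr0 0); apply: cvgD; last exact: h2t_cvg0.
    by rewrite -[X in _ --> X](mulr0 2); apply: cvgMr; exact: g_fun_cvg0.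
  apply: h2_cvg0.
    by apply: filterS near_le1 => e /andP[e0 _]; exact: arr_mass_excess01.
  rewrite -[X in _ --> X](subrr (arr_mass p)) -mass1.
  by apply: cvgB; [exact: cvg_cst|exact: arr_mass_excess_cvg].
(* The gap [M' - M] leaves room for the error terms, which tend to 0. *)
have [M' MM' M'p] : exists2 M', M < M' & (M'%:E < info p)%E.
  move: Mp; case: (info p) => [r| |] //.
    by rewrite lte_fin => Mr; exists ((M + r) / 2); rewrite ?lte_fin; lra.
  by move=> _; exists (M + 1); rewrite ?ltry// ltrDl.
have p_gt0 : 0 < arr_mass p by rewrite mass1.
have near_info := info_excess_lsc sp p_gt0 M'p.
have near_err : \forall e \near 0^'+, err e < M' - M.
  by apply: (cvgr_lt _ err0); rewrite subr_gt0.
apply: filterS3 near_le1 near_info near_err => e /andP[e0 _].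
rewrite /excess_rhs hext_mutual_info; last exact: summable_excess (ltW e0).
rewrite /err; case: (info (excess_arr p e)) => [x| |] //=.
- by rewrite !lte_fin; lra.
- by move=> _ _; rewrite ltry.
Unshelve. all: by end_near. Qed.

(** Squeezed between [excess_rhs] and the constant [mutual_info p], so the information of the
    truncated array need not be estimated directly. *)
Lemma trunc_rhs_cvg : (mutual_info p < +oo)%E ->
  trunc_rhs eps @[eps --> 0^'+] --> mutual_info p.
Proof.
move=> py; apply: squeeze_cvge excess_rhs_cvg (cvg_cst _).
near=> e.
have e0 : 0 < e by near: e; exact: nbhs_right_gt.
have e1 : e <= 1 by near: e; exact: nbhs_right_le.
rewrite excess_rhs_le_trunc_rhs//=.
exact: le_trans (trunc_rhs_le_lower_env py e0 e1) (lower_env_le (ltW e0)).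
Unshelve. all: by end_near. Qed.

End Proposition9.

Theorem proposition9 (R : realType) :
  (forall p : nat * nat -> R, is_distr p ->
    let rhs (eps : R) : \bar R :=
      (hext mutual_info (excess_arr p eps) - (2 * g_fun eps)%:E - (h2t eps)%:E
        - (h2 (1 - arr_mass (excess_arr p eps)))%:E)%E in
    (forall eps : R, 0 < eps -> eps <= 1 ->
      (lower_env mutual_info p eps >= rhs eps)%E)
    /\ rhs eps @[eps --> 0^'+] --> mutual_info p)
  /\
  (forall p : nat * nat -> R, is_distr p -> (mutual_info p < +oo)%E ->
    let rhs (eps : R) : \bar R :=
      (mutual_info p - hext mutual_info (trunc_arr p eps) - (2 * g_fun eps)%:E - (h2t eps)%:E)%E in
    (forall eps : R, 0 < eps -> eps <= 1 ->
      (lower_env mutual_info p eps >= rhs eps)%E)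
    /\ rhs eps @[eps --> 0^'+] --> mutual_info p).
Proof.
split=> p dp.
  by split; [exact: excess_rhs_le_lower_env|exact: excess_rhs_cvg].
move=> py; split; last exact: trunc_rhs_cvg.
by move=> eps; exact: trunc_rhs_le_lower_env.
Qed.
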